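(* The minimal logic of implicative lattices is complete in the class $\mathbb{L}$ of frames: if $[\![\varphi]\!]_{\mathfrak{M}}\subseteq[\![\psi]\!]_{\mathfrak{M}}$ for every model $\mathfrak{M}=(\mathfrak{F},V)$ on a frame $\mathfrak{F}\in\mathbb{L}$, then $\varphi\vdash\psi$ is provable.
   Context: Logic (integral case, the truth constant being identified with $\top$). Sentences: $\varphi::=p_i\,(i\in\mathbb{N})\mid\top\mid\bot\mid\varphi\wedge\varphi\mid\varphi\vee\varphi\mid\varphi\to\varphi$. Sequents $\varphi\vdash\psi$ are generated by: $\varphi\vdash\varphi$; $\varphi\vdash\top$; $\bot\vdash\varphi$; cut; uniform substitution; the two-way rule $\varphi\vdash\psi$ iff $\top\vdash\varphi\to\psi$; from $\psi\vdash\vartheta$ infer $\varphi\to\psi\vdash\varphi\to\vartheta$ and $\vartheta\to\varphi\vdash\psi\to\varphi$; the usual rules for $\wedge$ as greatest lower bound and for $\vee$ as least upper bound with respect to $\vdash$; and the axioms $(\varphi\to\psi)\wedge(\varphi\to\vartheta)\vdash\varphi\to(\psi\wedge\vartheta)$ and $(\varphi\to\vartheta)\wedge(\psi\to\vartheta)\vdash(\varphi\vee\psi)\to\vartheta$. Frames. $\mathfrak{F}=(W_1,W_\partial,I,T)$: $W_1,W_\partial$ nonempty sets (not necessarily disjoint), $I\subseteq W_1\times W_\partial$, $T\subseteq W_\partial\times(W_1\times W_\partial)$. Let $\perp$ be the complement of $I$. For $A\subseteq W_1$, $A'=\{y\in W_\partial\mid\forall x\in A\;x\perp y\}$; for $B\subseteq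 W_\partial$, $B'=\{x\in W_1\mid\forall y\in B\;x\perp y\}$. Galois sets are subsets $G$ of $W_1$ (stable) or $W_\partial$ (co-stable) with $G=G''$. $Txv=\{y\in W_\partial\mid yTxv\}$; the Galois dual $T'$ is given by $uT'xv$ iff $u\in(Txv)'$. $\mathbb{L}$ is the class of frames satisfying: (F1) for all $x\in W_1,v\in W_\partial$, $Txv$ is a Galois set; (F2) for all $x\in W_1,v\in W_\partial$: $x\perp v$ iff $uT'xv$ for all $u\in W_1$; (F3a) for all $x,z\in W_1$ the section $\{y\in W_\partial\mid xT'zy\}$ is a Galois (co-stable) set; (F3b) for all $x\in W_1$, $v\in W_\partial$ the section $\{z\in W_1\mid xT'zv\}$ is a Galois (stable) set. Models. $V$ assigns a Galois stable set $V(p_i)\subseteq W_1$ to each $p_i$. $[\![p_i]\!]=V(p_i)$, $[\![\top]\!]=W_1$, $[\![\bot]\!]=(W_\partial)'$, $[\![\varphi\wedge\psi]\!]=[\![\varphi]\!]\cap[\![\psi]\!]$, $[\![\varphi\vee\psi]\!]=([\![\varphi]\!]'\cap[\![\psi]\!]')'$, $[\![\varphi\to\psi]\!]=\{u\in W_1\mid\forall x\in[\![\varphi]\!]\,\forall v\in[\![\psi]\!]'\;uT'xv\}$. *)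

(* Defs.v *)
From mathcomp Require Import all_boot.
From mathcomp Require Import boolp classical_sets.

Set Implicit Arguments.
Unset Strict Implicit.
Unset Printing Implicit Defensive.

Local Open Scope classical_set_scope.

Inductive sentence : Type :=
| Var (i : nat)
| Top
| Bot
| And (p q : sentence)
| Or (p q : sentence)
| Imp (p q : sentence).

Fixpoint sub_sentence (s : nat -> sentence) (p : sentence) : sentence :=
  match p with
  | Var i => s i
  | Top => Top
  | Bot => Bot
  | And p q => And (sub_sentence s p) (sub_sentence s q)
  | Or p q => Or (sub_sentence s p) (sub_sentence s q)
  | Imp p q => Imp (sub_sentence s p) (sub_sentence s q)
  end.

Inductive provable : sentence -> sentence -> Prop :=
| pr_refl p : provable p p
| pr_top p : provable p Top
| pr_bot p : provable Bot p
| pr_cut p q r : provable p q -> provable q r -> provable p r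
| pr_sub_sentence s p q : provable p q -> provable (sub_sentence s p) (sub_sentence s q)
| pr_imp_intro p q : provable p q -> provable Top (Imp p q)
| pr_imp_elim p q : provable Top (Imp p q) -> provable p q
| pr_imp_monor p q r : provable q r -> provable (Imp p q) (Imp p r)
| pr_imp_antil p q r : provable q r -> provable (Imp r p) (Imp q p)
| pr_and_l p q : provable (And p q) p
| pr_and_r p q : provable (And p q) q
| pr_and_glb p q r : provable r p -> provable r q -> provable r (And p q)
| pr_or_l p q : provable p (Or p q)
| pr_or_r p q : provable q (Or p q)
| pr_or_lub p q r : provable p r -> provable q r -> provable (Or p q) r
| pr_imp_and p q r :
    provable (And (Imp p q) (Imp p r)) (Imp p (And q r))
| pr_or_imp p q r :
    provable (And (Imp p r) (Imp q r)) (Imp (Or p q) r).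

(* The two sorts are types, so overlap between them is not represented: no
   definition below compares a point of [W1] with a point of [Wd]. *)
Record frame := Frame {
  W1 : Type;
  Wd : Type;
  W1_nonempty : [set: W1] !=set0;
  Wd_nonempty : [set: Wd] !=set0;
  frI : W1 -> Wd -> Prop;
  (* [frT y x v] is the paper's yTxv. *)
  frT : Wd -> W1 -> Wd -> Prop
}.

Section FrameTheory.
Variable F : frame.

Definition perp (x : W1 F) (y : Wd F) : Prop := ~ frI x y.

Definition rpolar (A : set (W1 F)) : set (Wd F) :=
  [set y | forall x, A x -> perp x y].

Definition lpolar (B : set (Wd F)) : set (W1 F) :=
  [set x | forall y, B y -> perp x y].

Definition stable (A : set (W1 F)) : Prop := A = lpolar (rpolar A).

Definition costable (B : set (Wd F)) : Prop := B = rpolar (lpolar B).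

Definition secT (x : W1 F) (v : Wd F) : set (Wd F) := [set y | frT y x v].

(* The Galois dual relation: [dualT u x v] is uT'xv. *)
Definition dualT (u x : W1 F) (v : Wd F) : Prop := lpolar (secT x v) u.

End FrameTheory.

Record classL (F : frame) : Prop := ClassL {
  axF1 : forall (x : W1 F) (v : Wd F), costable (secT x v);
  axF2 : forall (x : W1 F) (v : Wd F), perp x v <-> forall u, dualT u x v;
  axF3a : forall x z : W1 F, costable [set y | dualT x z y];
  axF3b : forall (x : W1 F) (v : Wd F), stable [set z | dualT x z v]
}.

Record model := Model {
  model_frame :> frame;
  valuation : nat -> set (W1 model_frame);
  valuation_stable : forall i, stable (valuation i)
}.

Section Interpretation.
Variable M : model.

Fixpoint interp (p : sentence) : set (W1 M) :=
  match p with
  | Var i => valuation i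
  | Top => setT
  | Bot => lpolar setT
  | And p q => interp p `&` interp q
  | Or p q => lpolar (rpolar (interp p) `&` rpolar (interp q))
  | Imp p q =>
      [set u | forall x v, interp p x -> rpolar (interp q) v -> dualT u x v]
  end.

End Interpretation.

Arguments interp M p : clear implicits.

(* Main.v *)
(** Canonical model: worlds are the filters and co-worlds the ideals of sentences
    under provability (improper ones included), with [x] orthogonal to [v] iff
    they meet.  The relation [y T x v] says that the ideal [y] contains
    every [a -> b] with [a] in [x], [b] in [v]; these implications generate an
    ideal as they are directed upwards, so [u T' x v] means that some such
    [a -> b] lies in [u].  The two distribution axioms make the sections in (F3)
    polars of single points: [{b | a -> b in u, some a in z}] is a filter and
    [{a | a -> b in u, some b in v}] is an ideal.  By induction, a sentence is
    interpreted as the set of filters containing it; evaluating at the principal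
    filter of [phi] gives completeness. *)
Require Import Defs.
From mathcomp Require Import all_boot.
From mathcomp Require Import boolp classical_sets.

Set Implicit Arguments.
Unset Strict Implicit.
Unset Printing Implicit Defensive.

Local Open Scope classical_set_scope.

Lemma provable_TopImp p q r : provable p q -> provable r (Imp p q).
Proof. by move=> h; apply: pr_cut (pr_top _) (pr_imp_intro h). Qed.

Lemma provable_Imp p p' q q' :
  provable p' p -> provable q q' -> provable (Imp p q) (Imp p' q').
Proof. by move=> hp hq; apply: pr_cut (pr_imp_antil _ hp) (pr_imp_monor _ hq). Qed.

Lemma provable_And p p' q q' :
  provable p p' -> provable q q' -> provable (And p q) (And p' q').
Proof.
move=> hp hq; apply: pr_and_glb.
  exact: pr_cut (pr_and_l _ _) hp.
exact: pr_cut (pr_and_r _ _) hq.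
Qed.

Record pfilter := PFilter {
  filter_set :> sentence -> Prop;
  filter_Top : filter_set Top;
  filter_up : forall p q, provable p q -> filter_set p -> filter_set q;
  filter_And : forall p q, filter_set p -> filter_set q -> filter_set (And p q)
}.

Record pideal := PIdeal {
  ideal_set :> sentence -> Prop;
  ideal_Bot : ideal_set Bot;
  ideal_down : forall p q, provable p q -> ideal_set q -> ideal_set p;
  ideal_Or : forall p q, ideal_set p -> ideal_set q -> ideal_set (Or p q)
}.

Definition principal_filter (p : sentence) : pfilter.
Proof.
exists [set q | provable p q] => /=.
- exact: pr_top.
- by move=> q r qr pq; apply: pr_cut pq qr.
- by move=> q r; apply: pr_and_glb.
Defined.

Definition principal_ideal (p : sentence) : pideal.
Proof.
exists [set q | provable q p] => /=.
- exact: pr_bot.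
- by move=> q r qr rp; apply: pr_cut qr rp.
- by move=> q r; apply: pr_or_lub.
Defined.

Definition imp_ideal (x : pfilter) (v : pideal) : pideal.
Proof.
exists [set p | exists a b, [/\ x a, v b & provable p (Imp a b)]] => /=.
- exists Top, Bot; split; [exact: filter_Top | exact: ideal_Bot | exact: pr_bot].
- by move=> p q pq [a [b [xa vb qab]]]; exists a, b; split=> //; apply: pr_cut pq qab.
- move=> p q [a [b [xa vb pab]]] [c [d [xc vd qcd]]].
  (* Strengthening the antecedent and weakening the consequent puts both [Imp a b] and [Imp c d]
     below this one implication. *)
  exists (And a c), (Or b d); split; [exact: filter_And | exact: ideal_Or |].
  apply: pr_or_lub.
    by apply: (pr_cut pab); apply: provable_Imp; [apply: pr_and_l | apply: pr_or_l].
  by apply: (pr_cut qcd); apply: provable_Imp; [apply: pr_and_r | apply: pr_or_r].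
Defined.

Definition consequent_filter (u z : pfilter) : pfilter.
Proof.
exists [set b | exists2 a, z a & u (Imp a b)] => /=.
- exists Top; first exact: filter_Top.
  by apply: filter_up (filter_Top u); apply: provable_TopImp (pr_top _).
- move=> p q pq [a za uap]; exists a => //.
  by apply: filter_up uap; apply: pr_imp_monor.
- move=> p q [a za uap] [c zc ucq]; exists (And a c); first exact: filter_And.
  apply: filter_up (filter_And uap ucq).
  (* Both antecedents are strengthened to [And a c], so that the distribution axiom applies. *)
  apply: pr_cut (pr_imp_and _ _ _).
  by apply: provable_And; apply: pr_imp_antil; [apply: pr_and_l | apply: pr_and_r].
Defined.

Definition antecedent_ideal (u : pfilter) (v : pideal) : pideal.
Proof.
exists [set a | exists2 b, v b & u (Imp a b)] => /=.
- exists Bot; first exact: ideal_Bot.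
  by apply: filter_up (filter_Top u); apply: provable_TopImp (pr_bot _).
- move=> p q pq [b vb uqb]; exists b => //.
  by apply: filter_up uqb; apply: pr_imp_antil.
- move=> p q [b vb upb] [d vd uqd]; exists (Or b d); first exact: ideal_Or.
  apply: filter_up (filter_And upb uqd).
  apply: pr_cut (pr_or_imp _ _ _).
  by apply: provable_And; apply: pr_imp_monor; [apply: pr_or_l | apply: pr_or_r].
Defined.

(** [frI] is a negation because [perp] is its complement; orthogonality becomes a double negation,
    removed classically. *)
Definition canonical_frame : frame :=
  @Frame pfilter pideal
    (ex_intro _ (principal_filter Top) Logic.I)
    (ex_intro _ (principal_ideal Bot) Logic.I)
    (fun x v => ~ exists p, x p /\ v p)
    (fun y x v => forall p, imp_ideal x v p -> y p).

Lemma canonical_perpE (x : pfilter) (v : pideal) :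
  @perp canonical_frame x v <-> exists p, x p /\ v p.
Proof. by split=> [/contrapT|h]; [ | apply]. Qed.

(** The ideals extending [v] have a least member, [v] itself, so it suffices to meet that one. *)
Lemma lpolar_supideals (v : pideal) :
  @lpolar canonical_frame [set y : pideal | forall p, v p -> y p]
  = [set u : pfilter | exists p, u p /\ v p].
Proof.
apply/seteqP; split=> u /=.
  by move=> /(_ v (fun=> id))/canonical_perpE.
move=> [p [up vp]] y vy; apply/canonical_perpE.
by exists p; split=> //; apply: vy.
Qed.

Lemma rpolar_meeting (v : pideal) :
  @rpolar canonical_frame [set u : pfilter | exists p, u p /\ v p]
  = [set y : pideal | forall p, v p -> y p].
Proof.
apply/seteqP; split=> y /=.
  move=> h p vp; have [|q [pq yq]] := (canonical_perpE _ _).1 (h (principal_filter p) _).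
    by exists p; split=> //; apply: pr_refl.
  exact: ideal_down pq yq.
move=> vy u [p [up vp]]; apply/canonical_perpE.
by exists p; split=> //; apply: vy.
Qed.

(** The principal filter of [p] is the least filter containing [p], and an ideal that meets it
    contains [p] by downward closure. *)
Lemma rpolar_containing (p : sentence) :
  @rpolar canonical_frame [set x : pfilter | x p] = [set y : pideal | y p].
Proof.
apply/seteqP; split=> y /=.
  move=> /(_ (principal_filter p) (pr_refl p))/canonical_perpE[q [pq yq]].
  exact: ideal_down pq yq.
by move=> yp x xp; apply/canonical_perpE; exists p.
Qed.

Lemma lpolar_containing (p : sentence) :
  @lpolar canonical_frame [set y : pideal | y p] = [set x : pfilter | x p].
Proof.
apply/seteqP; split=> x /=.
  move=> /(_ (principal_ideal p) (pr_refl p))/canonical_perpE[q [xq qp]].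
  exact: filter_up qp xq.
by move=> xp y yp; apply/canonical_perpE; exists p.
Qed.

Lemma canonical_dualTE (u x : pfilter) (v : pideal) :
  @dualT canonical_frame u x v <-> exists a b, [/\ x a, v b & u (Imp a b)].
Proof.
rewrite /dualT (lpolar_supideals (imp_ideal x v)) /=; split.
  move=> [p [up [a [b [xa vb pab]]]]]; exists a, b; split=> //.
  exact: filter_up pab up.
move=> [a [b [xa vb uab]]]; exists (Imp a b); split=> //.
by exists a, b; split=> //; apply: pr_refl.
Qed.

(** Three polars in a row reduce to one; (F1) and (F3) thus only require writing each section as a
    polar. *)
Lemma costable_rpolar (F : frame) (A : set (W1 F)) : costable (rpolar A).
Proof.
apply/seteqP; split=> y h x hx; first exact: hx.
by apply: h => z; apply.
Qed.

Lemma stable_lpolar (F : frame) (B : set (Wd F)) : stable (lpolar B).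
Proof.
apply/seteqP; split=> x h y hy; first exact: hy.
by apply: h => z; apply.
Qed.

Lemma canonical_classL : classL canonical_frame.
Proof.
split.
- move=> x v; rewrite /secT -[X in costable X](rpolar_meeting (imp_ideal x v)).
  exact: costable_rpolar.
- move=> x v; split.
    move=> /canonical_perpE[p [xp vp]] u; apply/canonical_dualTE.
    (* The theorem [Imp p p] lies in every filter. *)
    exists p, p; split=> //.
    by apply: filter_up (filter_Top u); apply: provable_TopImp (pr_refl p).
  (* The least filter contains only theorems, so the implication found in it is a provable sequent
     from [a] to [b]. *)
  move=> /(_ (principal_filter Top))/canonical_dualTE[a [b [xa vb ab]]].
  apply/canonical_perpE; exists b; split=> //.
  exact: filter_up (pr_imp_elim ab) xa.
- move=> u z; suff -> : [set y | @dualT canonical_frame u z y]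
      = rpolar [set consequent_filter u z : W1 canonical_frame].
    exact: costable_rpolar.
  apply/seteqP; split=> y /=.
    move=> /canonical_dualTE[a [b [za yb uab]]] _ ->; apply/canonical_perpE.
    by exists b; split=> //; exists a.
  move=> /(_ _ erefl)/canonical_perpE[b [[a za uab] yb]].
  by apply/canonical_dualTE; exists a, b.
- move=> u v; suff -> : [set z | @dualT canonical_frame u z v]
      = lpolar [set antecedent_ideal u v : Wd canonical_frame].
    exact: stable_lpolar.
  apply/seteqP; split=> z /=.
    move=> /canonical_dualTE[a [b [za vb uab]]] _ ->; apply/canonical_perpE.
    by exists a; split=> //; exists b.
  move=> /(_ _ erefl)/canonical_perpE[a [za [b vb uab]]].
  by apply/canonical_dualTE; exists a, b.
Qed.

Lemma stable_containing (p : sentence) :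
  @stable canonical_frame [set x : pfilter | x p].
Proof. by rewrite -lpolar_containing; apply: stable_lpolar. Qed.

Definition canonical_model : model :=
  @Model canonical_frame (fun i => [set x : pfilter | x (Var i)])
    (fun i => stable_containing (Var i)).

Lemma canonical_interpE (p : sentence) :
  interp canonical_model p = [set x : pfilter | x p].
Proof.
elim: p => [i|||p IHp q IHq|p IHp q IHq|p IHp q IHq] //=.
- by apply/seteqP; split=> x //= _; apply: filter_Top.
(* Every ideal contains [Bot], so the full set of co-worlds is the set of ideals containing
   [Bot]. *)
- rewrite -lpolar_containing; apply: (congr1 (@lpolar canonical_frame)).
  by apply/seteqP; split=> y //= _; apply: ideal_Bot.
- rewrite IHp IHq; apply/seteqP; split=> x /=.
    by move=> [xp xq]; apply: filter_And.
  by move=> xpq; split; apply: filter_up xpq; [apply: pr_and_l | apply: pr_and_r].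
- rewrite IHp IHq !rpolar_containing -lpolar_containing.
  apply: (congr1 (@lpolar canonical_frame)).
  apply/seteqP; split=> y /=.
    by move=> [yp yq]; apply: ideal_Or.
  by move=> ypq; split; apply: ideal_down ypq; [apply: pr_or_l | apply: pr_or_r].
- rewrite IHp IHq rpolar_containing; apply/seteqP; split=> u /=.
    (* Testing at these two points gives [Imp a b] in [u] with [a] above [p] and [b] below [q],
       hence [Imp p q] in [u]. *)
    move=> /(_ (principal_filter p) (principal_ideal q) (pr_refl p) (pr_refl q)).
    move=> /canonical_dualTE[a [b [pa bq uab]]].
    by apply: filter_up uab; apply: provable_Imp.
  by move=> upq x v xp vq; apply/canonical_dualTE; exists p, q.
Qed.

Theorem theorem6p2 (phi psi : sentence) :
  (forall M : model, classL (model_frame M) -> interp M phi `<=` interp M psi) ->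
  provable phi psi.
Proof.
move=> /(_ canonical_model canonical_classL); rewrite !canonical_interpE.
by move=> /(_ (principal_filter phi) (pr_refl phi)).
Qed.
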